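(* Let $\mathfrak{F}$ be an arbitrary interpolation functor defined on the category of all interpolation pairs of quasi-Banach spaces (resp., of Banach spaces). Suppose that six quasi-Banach spaces (resp., Banach spaces) $X_{0}$, $Y_{0}$, $Z_{0}$, $X_{1}$, $Y_{1}$, $Z_{1}$ and three linear mappings $T$, $R$, $S$ are given and satisfy the following conditions: (i) The pairs $[X_0,X_1]$ and $[Y_0,Y_1]$ are interpolation pairs. (ii) The spaces $Y_{0}$, $Z_{0}$, $Y_{1}$, and $Z_{1}$ are linear manifolds in a certain linear space. (iii) The continuous embeddings $Y_{0}\hookrightarrow Z_{0}$ and $Y_{1}\hookrightarrow Z_{1}$ hold true. (iv) The mapping $T$ acts from $X_0+X_1$ to $Z_0+Z_1$, and its restriction to $X_j$ is a bounded operator $T:X_j\to Z_j$ for each $j\in\{0,1\}$. (v) The mapping $R$ acts from $Z_0+Z_1$ to $X_0+X_1$, and its restriction to $Z_j$ is a bounded operator $R:Z_j\to X_j$ for each $j\in\{0,1\}$. (vi) The mapping $S$ acts on $Z_0+Z_1$, and its restriction to $Z_j$ is a bounded operator $S:Z_j\to Y_j$ for each $j\in\{0,1\}$. (vii) $TRw=w+Sw$ for every $w\in Z_0+Z_1$. Then the equality of spaces $$\mathfrak{F}[X_{0}(T,Y_{0}),X_{1}(T,Y_{1})]=(\mathfrak{F}[X_{0},X_{1}])(T,\mathfrak{F}[Y_{0},Y_{1}])$$ holds true up to equivalence of quasi-norms, and these spaces are well defined.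
   Context: All linear spaces are complex and all topological spaces are Hausdorff. $Y\hookrightarrow Z$ means that $Y$ is a linear manifold in $Z$ and that the identity mapping is continuous from $Y$ to $Z$. If $X$, $Y$ are quasi-Banach spaces and $T$ is a linear mapping defined on $X$ with values in a linear space containing $Y$ as a linear manifold, then $X(T,Y)=(X)(T,Y):=\{u\in X: Tu\in Y\}$, endowed with the graph quasi-norm $\|u\|_{X(T,Y)}:=\|u\|_{X}+\|Tu\|_{Y}$. An ordered pair $[X_0,X_1]$ of quasi-Banach spaces is called an interpolation pair if both are continuously embedded in a certain linear topological space. Then $X_0\cap X_1$ is endowed with the quasi-norm $\max\{\|u\|_{X_0},\|u\|_{X_1}\}$ and $X_0+X_1$ with the quasi-norm $\inf\{\|u_0\|_{X_0}+\|u_1\|_{X_1}:u_0\in X_0,u_1\in X_1,u_0+u_1=u\}$. An interpolation functor $\mathfrak{F}$ on the category of interpolation pairs of quasi-Banach (resp., Banach) spaces is characterized by: (a) for every such pair $[X_0,X_1]$, $\mathfrak{F}[X_0,X_1]$ is a quasi-Banach (resp., Banach) space with continuous embeddings $X_0\cap X_1\hookrightarrow\mathfrak{F}[X_0,X_1]\hookrightarrow X_0+X_1$; (b) if $[X_0,X_1]$ and $[Y_0,Y_1]$ are such pairs and $T:X_0+X_1\to Y_0+Y_1$ is a linear operator whose restrictions $T:X_0\to Y_0$ and $T:X_1\to Y_1$ are bounded, then the restriction of $T$ to $\mathfrak{F}[X_0,X_1]$ is a bounded operator $T:\mathfrak{F}[X_0,X_1]\to\mathfrak{F}[Y_0,Y_1]$.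 *)

(* Defs.v *)
From HB Require Import structures.
From mathcomp Require Import all_boot all_order all_algebra.
From mathcomp Require Import all_classical all_reals all_analysis.
From mathcomp Require Import complex.

Set Implicit Arguments.
Unset Strict Implicit.
Unset Printing Implicit Defensive.

Import Order.TTheory GRing.Theory Num.Theory.
Import numFieldNormedType.Exports.

Local Open Scope classical_set_scope.
Local Open Scope ring_scope.

(* A space given as a linear manifold in a complex linear space V, together
   with its quasi-norm. The values of qnorm outside the carrier carry no
   information: every notion below only looks at qnorm on the carrier. *)
Record qspace (R : realType) (V : lmodType R[i]) := QSpace {
  carrier : set V;
  qnorm : V -> R
}.

(* Neighbourhoods of x in the quasi-norm topology of X; the filter lives on V
   and is generated by the balls of X (which are subsets of the carrier). *)
Definition qnbhs (R : realType) (V : lmodType R[i]) (X : qspace V) (x : V) :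
    set_system V :=
  filter_from [set e : R | 0 < e]
    (fun e => [set y | carrier X y /\ qnorm X (y - x) < e]).

Definition qcauchy (R : realType) (V : lmodType R[i]) (X : qspace V)
    (u : nat -> V) : Prop :=
  forall e : R, 0 < e ->
    exists N, forall m n, (N <= m)%N -> (N <= n)%N -> qnorm X (u m - u n) < e.

Record quasi_banach (R : realType) (V : lmodType R[i]) (X : qspace V) : Prop :=
  QuasiBanachSpace {
  carrier0 : carrier X 0;
  carrier_lin : forall (a : R[i]) x y,
    carrier X x -> carrier X y -> carrier X (a *: x + y);
  qnorm_ge0 : forall x, carrier X x -> 0 <= qnorm X x;
  qnorm_eq0 : forall x, carrier X x -> qnorm X x = 0 -> x = 0;
  qnormZ : forall (a : R[i]) x,
    carrier X x -> qnorm X (a *: x) = Normc.normc a * qnorm X x;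
  qnormD : exists c : R, forall x y, carrier X x -> carrier X y ->
    qnorm X (x + y) <= c * (qnorm X x + qnorm X y);
  qcomplete : forall u : nat -> V, (forall n, carrier X (u n)) ->
    qcauchy X u -> exists2 x, carrier X x & u @ \oo `=>` qnbhs X x
}.

Definition banach (R : realType) (V : lmodType R[i]) (X : qspace V) : Prop :=
  quasi_banach X /\
  forall x y, carrier X x -> carrier X y ->
    qnorm X (x + y) <= qnorm X x + qnorm X y.

Variant space_kind := QuasiBanach | Banach.

Definition is_space (R : realType) (k : space_kind) (V : lmodType R[i])
    (X : qspace V) : Prop :=
  match k with QuasiBanach => quasi_banach X | Banach => banach X end.

Definition embedded (R : realType) (V : lmodType R[i]) (Y Z : qspace V) :
    Prop :=
  carrier Y `<=` carrier Z /\
  forall x, carrier Y x -> qnbhs Y x `=>` qnbhs Z x.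

Definition cap_space (R : realType) (V : lmodType R[i]) (X0 X1 : qspace V) :
    qspace V :=
  QSpace (carrier X0 `&` carrier X1)
    (fun u => Num.max (qnorm X0 u) (qnorm X1 u)).

Definition sum_space (R : realType) (V : lmodType R[i]) (X0 X1 : qspace V) :
    qspace V :=
  QSpace
    [set u | exists u0 u1, [/\ carrier X0 u0, carrier X1 u1 & u0 + u1 = u]]
    (fun u => inf [set r : R | exists u0 u1,
       [/\ carrier X0 u0, carrier X1 u1, u0 + u1 = u
         & r = qnorm X0 u0 + qnorm X1 u1]]).

(* Operators are total functions of which only the restriction to a linear
   manifold matters. *)
Definition linear_on (R : realType) (V W : lmodType R[i]) (A : set V)
    (f : V -> W) : Prop :=
  forall (a : R[i]) x y, A x -> A y -> f (a *: x + y) = a *: f x + f y.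

Definition linear_map (R : realType) (V W : lmodType R[i]) (A : set V)
    (B : set W) (f : V -> W) : Prop :=
  linear_on A f /\ forall x, A x -> B (f x).

Definition bounded_from_to (R : realType) (V W : lmodType R[i])
    (X : qspace V) (Y : qspace W) (f : V -> W) : Prop :=
  (forall x, carrier X x -> carrier Y (f x)) /\
  exists c : R, forall x, carrier X x -> qnorm Y (f x) <= c * qnorm X x.

(* The space X(T,Y). *)
Definition graph_space (R : realType) (V W : lmodType R[i])
    (X : qspace V) (T : V -> W) (Y : qspace W) : qspace V :=
  QSpace [set u | carrier X u /\ carrier Y (T u)]
    (fun u => qnorm X u + qnorm Y (T u)).

(* X0 and X1 are continuously embedded in a Hausdorff linear topological space
   H, not assumed locally convex. The linear space V in which X0 and X1 are
   given carries no topology; j identifies its manifold X0 + X1 with a linear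
   manifold of H. *)
Definition interpolation_pair (R : realType) (k : space_kind)
    (V : lmodType R[i]) (X0 X1 : qspace V) : Prop :=
  [/\ is_space k X0, is_space k X1 &
   exists (H : topologicalLmodType R[i]) (j : V -> H),
     [/\ hausdorff_space H,
         linear_on (carrier (sum_space X0 X1)) j,
         {in carrier (sum_space X0 X1) &, injective j},
         (forall x, carrier X0 x -> j @ qnbhs X0 x --> j x)
       & (forall x, carrier X1 x -> j @ qnbhs X1 x --> j x)]].

(* The functor is only applied to pairs X0, X1 together with a proof that they
   form an interpolation pair of spaces of kind k. *)
Record interpolation_functor (R : realType) (k : space_kind) := InterpFunctor {
  interp : forall (V : lmodType R[i]) (X0 X1 : qspace V),
    interpolation_pair k X0 X1 -> qspace V;
  interp_space : forall (V : lmodType R[i]) (X0 X1 : qspace V)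
    (hX : interpolation_pair k X0 X1), is_space k (interp hX);
  interp_cap : forall (V : lmodType R[i]) (X0 X1 : qspace V)
    (hX : interpolation_pair k X0 X1),
    embedded (cap_space X0 X1) (interp hX);
  interp_sum : forall (V : lmodType R[i]) (X0 X1 : qspace V)
    (hX : interpolation_pair k X0 X1),
    embedded (interp hX) (sum_space X0 X1);
  interp_bounded : forall (V W : lmodType R[i])
    (X0 X1 : qspace V) (Y0 Y1 : qspace W)
    (hX : interpolation_pair k X0 X1) (hY : interpolation_pair k Y0 Y1)
    (T : V -> W),
    linear_map (carrier (sum_space X0 X1)) (carrier (sum_space Y0 Y1)) T ->
    bounded_from_to X0 Y0 T -> bounded_from_to X1 Y1 T ->
    bounded_from_to (interp hX) (interp hY) T
}.

Definition equal_spaces (R : realType) (V : lmodType R[i]) (X Y : qspace V) :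
    Prop :=
  carrier X = carrier Y /\
  exists c : R, forall x, carrier X x ->
    qnorm X x <= c * qnorm Y x /\ qnorm Y x <= c * qnorm X x.

(* Main.v *)
Require Import Defs.
From HB Require Import structures.
From mathcomp Require Import all_boot all_order all_algebra.
From mathcomp Require Import all_classical all_reals all_analysis.
From mathcomp Require Import complex.

(* With G_j := X_j(T, Y_j), both Q : Y_j -> G_j and P := 1 - Q T : X_j -> G_j
   are bounded, because T Q = 1 + S and T P = - S T; the identity G_j -> X_j
   and T : G_j -> Y_j are bounded by the definition of the graph norm. Applying
   the functor to these four operators gives both inclusions, the nontrivial
   one through u = P u + Q (T u). Completeness of the graph spaces requires T to
   have a closed graph, for which Z0 + Z1 has to be separated. This follows
   from w = T (Q w) - S w: if w lies in the closure of 0, then Q w and S w lie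
   in the closures of 0 in X0 + X1 and Y0 + Y1, hence vanish. *)

Set Implicit Arguments.
Unset Strict Implicit.
Unset Printing Implicit Defensive.

Import Order.TTheory GRing.Theory Num.Theory.

Local Open Scope classical_set_scope.
Local Open Scope ring_scope.

(** * Algebra of carriers and quasi-norms *)

Lemma is_space_quasi_banach (R : realType) (k : space_kind) (V : lmodType R[i])
    (X : qspace V) : is_space k X -> quasi_banach X.
Proof. by case: k => // -[]. Qed.

Lemma carrierD (R : realType) (V : lmodType R[i]) (X : qspace V) (x y : V) :
  quasi_banach X -> carrier X x -> carrier X y -> carrier X (x + y).
Proof. by move=> qX Xx Xy; rewrite -[x]scale1r; exact: carrier_lin. Qed.

Lemma carrierB (R : realType) (V : lmodType R[i]) (X : qspace V) (x y : V) :
  quasi_banach X -> carrier X x -> carrier X y -> carrier X (x - y).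
Proof.
by move=> qX Xx Xy; rewrite addrC -scaleN1r; exact: carrier_lin.
Qed.

Lemma carrierZ (R : realType) (V : lmodType R[i]) (X : qspace V) (a : R[i])
    (x : V) : quasi_banach X -> carrier X x -> carrier X (a *: x).
Proof.
by move=> qX Xx; rewrite -[_ *: _]addr0; apply: carrier_lin => //; exact: carrier0.
Qed.

Lemma carrierN (R : realType) (V : lmodType R[i]) (X : qspace V) (x : V) :
  quasi_banach X -> carrier X x -> carrier X (- x).
Proof. by move=> qX Xx; rewrite -scaleN1r; exact: carrierZ. Qed.

Lemma qnormN (R : realType) (V : lmodType R[i]) (X : qspace V) (x : V) :
  quasi_banach X -> carrier X x -> qnorm X (- x) = qnorm X x.
Proof.
move=> qX Xx; rewrite -scaleN1r qnormZ//=.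
by rewrite oppr0 sqrrN expr1n expr0n addr0 sqrtr1 mul1r.
Qed.

Lemma qnorm0 (R : realType) (V : lmodType R[i]) (X : qspace V) :
  quasi_banach X -> qnorm X 0 = 0.
Proof.
move=> qX; rewrite -(scale0r (0 : V)) qnormZ; last exact: carrier0.
  by rewrite Normc.normc0 mul0r.
by [].
Qed.

(** Raising the constant to at least 1 makes it positive, so that it can multiply strict
    inequalities. *)
Lemma qnormDM (R : realType) (V : lmodType R[i]) (X : qspace V) :
  quasi_banach X -> exists2 c : R, 0 < c & forall x y,
    carrier X x -> carrier X y ->
    qnorm X (x + y) <= c * (qnorm X x + qnorm X y).
Proof.
move=> qX; have [c hc] := qnormD qX.
exists (Num.max c 1); first by rewrite lt_max ltr01 orbT.
move=> x y Xx Xy; apply: (le_trans (hc x y Xx Xy)).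
by apply: ler_wpM2r; [rewrite addr_ge0 ?(qnorm_ge0 qX)|rewrite le_max lexx].
Qed.

(** * Bounded operators *)

Lemma bounded_from_to_pos (R : realType) (V W : lmodType R[i])
    (X : qspace V) (Y : qspace W) (f : V -> W) :
  quasi_banach X -> bounded_from_to X Y f ->
  exists2 c : R, 0 < c &
    forall x, carrier X x -> qnorm Y (f x) <= c * qnorm X x.
Proof.
move=> qX [_ [c hc]].
exists (Num.max c 1); first by rewrite lt_max ltr01 orbT.
move=> x Xx; apply: (le_trans (hc x Xx)).
by apply: ler_wpM2r; [rewrite (qnorm_ge0 qX)|rewrite le_max lexx].
Qed.

Lemma bounded_from_to_comp (R : realType) (V1 V2 V3 : lmodType R[i])
    (X : qspace V1) (Y : qspace V2) (Z : qspace V3) (f : V1 -> V2)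
    (g : V2 -> V3) : quasi_banach Y ->
  bounded_from_to X Y f -> bounded_from_to Y Z g -> bounded_from_to X Z (g \o f).
Proof.
move=> qY [fXY [c hc]] bg; have [d d0 hd] := bounded_from_to_pos qY bg.
split=> [x /fXY|]; first exact: bg.1.
exists (d * c) => x Xx; apply: le_trans (hd _ (fXY _ Xx)) _.
by rewrite -mulrA ler_pM2l// hc.
Qed.

Lemma bounded_from_to_add (R : realType) (V W : lmodType R[i])
    (X : qspace V) (Y : qspace W) (f g : V -> W) : quasi_banach Y ->
  bounded_from_to X Y f -> bounded_from_to X Y g ->
  bounded_from_to X Y (f \+ g).
Proof.
move=> qY [fXY [c hc]] [gXY [d hd]]; have [e e0 he] := qnormDM qY.
split=> [x Xx|]; first by apply: carrierD => //; [exact: fXY|exact: gXY].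
exists (e * (c + d)) => x Xx.
apply: le_trans (he _ _ (fXY _ Xx) (gXY _ Xx)) _.
by rewrite -mulrA ler_pM2l// mulrDl lerD ?hc ?hd.
Qed.

Lemma bounded_from_to_opp (R : realType) (V W : lmodType R[i])
    (X : qspace V) (Y : qspace W) (f : V -> W) : quasi_banach Y ->
  bounded_from_to X Y f -> bounded_from_to X Y (\- f).
Proof.
move=> qY [fXY [c hc]]; split=> [x Xx|].
  by apply: carrierN => //; exact: fXY.
by exists c => x Xx; rewrite /= qnormN ?hc//; exact: fXY.
Qed.

(** Operators are total functions, so two of them that agree on the carrier may still differ
    elsewhere. *)
Lemma eq_bounded_from_to (R : realType) (V W : lmodType R[i])
    (X : qspace V) (Y : qspace W) (f g : V -> W) :
  (forall x, carrier X x -> f x = g x) ->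
  bounded_from_to X Y f -> bounded_from_to X Y g.
Proof.
move=> fg [fXY [c hc]]; split=> [x Xx|]; first by rewrite -fg//; exact: fXY.
by exists c => x Xx; rewrite -fg// hc.
Qed.

(** * Linearity on a subset *)

Lemma linear_onS (R : realType) (V W : lmodType R[i]) (A B : set V)
    (f : V -> W) : A `<=` B -> linear_on B f -> linear_on A f.
Proof. by move=> AB fB a x y Ax Ay; apply: fB; exact: AB. Qed.

Lemma linear_onD (R : realType) (V W : lmodType R[i]) (A : set V)
    (f : V -> W) (x y : V) :
  linear_on A f -> A x -> A y -> f (x + y) = f x + f y.
Proof. by move=> fA Ax Ay; rewrite -[x in LHS]scale1r fA// scale1r. Qed.

Lemma linear_onB (R : realType) (V W : lmodType R[i]) (A : set V)
    (f : V -> W) (x y : V) :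
  linear_on A f -> A x -> A y -> f (x - y) = f x - f y.
Proof.
by move=> fA Ax Ay; rewrite addrC -scaleN1r fA// scaleN1r addrC.
Qed.

Lemma linear_on0 (R : realType) (V W : lmodType R[i]) (A : set V)
    (f : V -> W) : linear_on A f -> A 0 -> f 0 = 0.
Proof. by move=> fA A0; rewrite -(subrr (0 : V)) (linear_onB fA)// subrr. Qed.

Lemma linear_onZ (R : realType) (V W : lmodType R[i]) (A : set V)
    (f : V -> W) (a : R[i]) (x : V) :
  linear_on A f -> A 0 -> A x -> f (a *: x) = a *: f x.
Proof.
by move=> fA A0 Ax; rewrite -[_ *: x]addr0 fA// (linear_on0 fA)// addr0.
Qed.

(** * Continuous embeddings as bounded identity maps *)

Lemma bounded_embedded (R : realType) (V : lmodType R[i]) (Y Z : qspace V) :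
  quasi_banach Y -> bounded_from_to Y Z idfun -> embedded Y Z.
Proof.
move=> qY bYZ; have [c c0 hc] := bounded_from_to_pos qY bYZ.
have YZ := bYZ.1; split=> // x Yx A [e e0 eA].
exists (e / c); first exact: divr_gt0.
move=> y [Yy yx]; apply: eA; split; first exact: YZ.
apply: le_lt_trans (hc _ (carrierB qY Yy Yx)) _.
by rewrite mulrC -ltr_pdivlMr.
Qed.

(** Continuity at 0 puts a ball of [Y] of some radius [d] inside the unit ball of [Z]; homogeneity
    turns this into the bound [2 / d]. *)
Lemma embedded_bounded (R : realType) (V : lmodType R[i]) (Y Z : qspace V) :
  quasi_banach Y -> quasi_banach Z -> embedded Y Z ->
  bounded_from_to Y Z idfun.
Proof.
move=> qY qZ [YZ cYZ]; split=> //.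
have : qnbhs Z 0 [set y | carrier Z y /\ qnorm Z (y - 0) < 1].
  by exists 1 => //=.
move=> /(cYZ 0 (carrier0 qY))[d /= d0 hd].
exists (2 / d) => x Yx.
have nx := qnorm_ge0 qY Yx.
have [x0|x0] := eqVneq (qnorm Y x) 0.
  by rewrite (qnorm_eq0 qY Yx x0) /= !qnorm0// mulr0.
have xgt0 : 0 < qnorm Y x by rewrite lt_def x0 nx.
(* Scaling by [a] brings [x] to quasi-norm [d / 2] in [Y], strictly inside the ball of radius
   [d]. *)
set a : R := d / 2 / qnorm Y x.
have a0 : 0 < a by rewrite !divr_gt0.
have na : Normc.normc (a%:C)%C = a.
  by rewrite /= expr0n addr0 sqrtr_sqr gtr0_norm.
have [|_] := hd ((a%:C)%C *: x).
  split; first exact: carrierZ.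
  rewrite subr0 (qnormZ qY)// na /a divfK// ltr_pdivrMr// ltr_pMr//.
  by rewrite ltr1n.
rewrite subr0 (qnormZ qZ) ?na//; last exact: YZ.
rewrite mulrC -ltr_pdivlMr// => /ltW/le_trans; apply.
by rewrite div1r /a !invf_div mulrC.
Qed.

(** * Sums of two spaces and their separation *)

Lemma carrier_sum_l (R : realType) (V : lmodType R[i]) (X0 X1 : qspace V) :
  quasi_banach X1 -> carrier X0 `<=` carrier (sum_space X0 X1).
Proof. by move=> q1 x X0x; exists x, 0; split; rewrite ?addr0//; exact: carrier0. Qed.

Lemma carrier_sum_r (R : realType) (V : lmodType R[i]) (X0 X1 : qspace V) :
  quasi_banach X0 -> carrier X1 `<=` carrier (sum_space X0 X1).
Proof. by move=> q1 x X0x; exists 0, x; split; rewrite ?add0r//; exact: carrier0. Qed.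

Lemma carrier_sum_mono (R : realType) (V : lmodType R[i])
    (X0 X1 Y0 Y1 : qspace V) :
  carrier X0 `<=` carrier Y0 -> carrier X1 `<=` carrier Y1 ->
  carrier (sum_space X0 X1) `<=` carrier (sum_space Y0 Y1).
Proof.
move=> s0 s1 _ [x0 [x1 [h0 h1 <-]]]; exists x0, x1.
by split=> //; [exact: s0|exact: s1].
Qed.

Lemma linear_map_sum (R : realType) (V W : lmodType R[i])
    (X0 X1 : qspace V) (Y0 Y1 : qspace W) (f : V -> W) :
  quasi_banach X0 -> quasi_banach X1 ->
  linear_on (carrier (sum_space X0 X1)) f ->
  bounded_from_to X0 Y0 f -> bounded_from_to X1 Y1 f ->
  linear_map (carrier (sum_space X0 X1)) (carrier (sum_space Y0 Y1)) f.
Proof.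
move=> q0 q1 lf [f0 _] [f1 _]; split=> // _ [x0 [x1 [h0 h1 <-]]].
exists (f x0), (f x1); split; [exact: f0|exact: f1|].
by rewrite (linear_onD lf)//; [exact: carrier_sum_l|exact: carrier_sum_r].
Qed.

(* These sets are the balls, up to equivalence, of the seminorm of X0 + X1. It
   need not be a quasi-norm unless [X0, X1] is an interpolation pair, which is
   not assumed of [Z0, Z1]. *)
Definition sum_small (R : realType) (V : lmodType R[i]) (X0 X1 : qspace V)
    (e : R) (w : V) : Prop :=
  exists a b, [/\ carrier X0 a, carrier X1 b, a + b = w,
    qnorm X0 a < e & qnorm X1 b < e].

(** The closure of 0 in the sum is trivial, which is the Hausdorff property of its seminorm
    topology. *)
Definition sum_separated (R : realType) (V : lmodType R[i])
    (X0 X1 : qspace V) : Prop :=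
  forall w, (forall e : R, 0 < e -> sum_small X0 X1 e w) -> w = 0.

(** If [w = a + b] with [a] and [b] arbitrarily small, then [j w = j a + j b] lies in every
    neighbourhood of 0 in the Hausdorff space [H]; hence [j w = 0], and [j] is injective. *)
Lemma interpolation_pair_separated (R : realType) (k : space_kind)
    (V : lmodType R[i]) (X0 X1 : qspace V) :
  interpolation_pair k X0 X1 -> sum_separated X0 X1.
Proof.
move=> [/is_space_quasi_banach q0 /is_space_quasi_banach q1].
move=> [H [j [hH lj ij c0 c1]]] w hw.
have s0 : carrier (sum_space X0 X1) 0.
  by apply: carrier_sum_l => //; exact: carrier0.
have sw : carrier (sum_space X0 X1) w.
  by have [a [b [? ? ? _ _]]] := hw 1 ltr01; exists a, b.
have j0 := linear_on0 lj s0.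
apply: ij; [exact/mem_set..|].
(* The common point of [A] and [B] will be [j w] itself, so only its membership in [B] is at
   stake. *)
apply: hH => A B jwA; rewrite j0 => B0.
have : nbhs ((0 : H) + 0) B by rewrite addr0.
(* Continuity of addition at the origin gives [B1] and [B2] with sum inside [B]; they will receive
   [j a] and [j b]. *)
move=> /(@add_continuous H (0, 0))[[B1 B2] /= [B1n B2n] B12].
rewrite -j0 in B1n B2n.
have [e1 /= e1p he1] := c0 0 (carrier0 q0) _ B1n.
have [e2 /= e2p he2] := c1 0 (carrier0 q1) _ B2n.
have [|a [b [Xa Xb abw ae be]]] := hw (Num.min e1 e2).
  by rewrite lt_min e1p.
exists (j w); split; first exact: nbhs_singleton.
rewrite -abw (linear_onD lj); last 2 first.
- exact: carrier_sum_l.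
- exact: carrier_sum_r.
apply: (B12 (j a, j b)); split => /=.
- apply: he1; split=> //; rewrite subr0.
  by move: ae; rewrite lt_min => /andP[].
- apply: he2; split=> //; rewrite subr0.
  by move: be; rewrite lt_min => /andP[].
Qed.

Lemma sum_small_map (R : realType) (V W : lmodType R[i])
    (X0 X1 : qspace V) (Y0 Y1 : qspace W) (f : V -> W) :
  quasi_banach X0 -> quasi_banach X1 ->
  linear_on (carrier (sum_space X0 X1)) f ->
  bounded_from_to X0 Y0 f -> bounded_from_to X1 Y1 f ->
  exists2 c : R, 0 < c & forall e w, 0 < e ->
    sum_small X0 X1 e w -> sum_small Y0 Y1 (c * e) (f w).
Proof.
move=> q0 q1 lf b0 b1.
have [c cp hc] := bounded_from_to_pos q0 b0.
have [d dp hd] := bounded_from_to_pos q1 b1.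
exists (c + d); first exact: addr_gt0.
move=> e _ ep [a [b [Xa Xb <- ae be]]].
exists (f a), (f b); split; [exact: b0.1|exact: b1.1| | |].
- by rewrite (linear_onD lf)//; [exact: carrier_sum_l|exact: carrier_sum_r].
- apply: le_lt_trans (hc _ Xa) _; rewrite mulrDl.
  by rewrite (lt_le_trans (_ : _ < c * e)) ?ltr_pM2l// lerDl ltW// mulr_gt0.
- apply: le_lt_trans (hd _ Xb) _; rewrite mulrDl.
  by rewrite (lt_le_trans (_ : _ < d * e)) ?ltr_pM2l// lerDr ltW// mulr_gt0.
Qed.

Lemma sum_smallB (R : realType) (V : lmodType R[i]) (X0 X1 : qspace V) :
  quasi_banach X0 -> quasi_banach X1 ->
  exists2 c : R, 0 < c & forall e w z, 0 < e ->
    sum_small X0 X1 e w -> sum_small X0 X1 e z ->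
    sum_small X0 X1 (c * e) (w - z).
Proof.
(* The factor 2 comes from the two terms below [e]; [c + d] is a common constant for both
   components. *)
have small c d e x y : 0 < c -> 0 < d -> 0 < e -> x < e -> y < e ->
    c * (x + y) < ((c + d) * 2) * e :> R.
  move=> cp dp ep xe ye; rewrite (@lt_trans _ _ (c * (e + e)))//.
    by rewrite ltr_pM2l// ltrD.
  by rewrite -mulrA mulr_natl -mulr2n ltr_pM2r ?ltrDl// pmulrn_lgt0.
move=> q0 q1; have [c cp hc] := qnormDM q0; have [d dp hd] := qnormDM q1.
exists ((c + d) * 2); first by rewrite mulr_gt0// addr_gt0.
move=> e _ _ ep [a [b [Xa Xb <- ae be]]] [a' [b' [Xa' Xb' <- ae' be']]].
have [Na Nb] := (carrierN q0 Xa', carrierN q1 Xb').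
exists (a - a'), (b - b'); split.
- exact: carrierB.
- exact: carrierB.
- by rewrite opprD addrACA.
- by apply: le_lt_trans (hc _ _ Xa Na) _; rewrite qnormN//; exact: small.
- apply: le_lt_trans (hd _ _ Xb Nb) _; rewrite qnormN// [c + d]addrC.
  exact: small.
Qed.

Lemma parametrix_separated (R : realType) (V W : lmodType R[i])
    (X0 X1 : qspace V) (Y0 Y1 Z0 Z1 : qspace W)
    (T : V -> W) (Q : W -> V) (S : W -> W) :
  quasi_banach X0 -> quasi_banach X1 ->
  quasi_banach Z0 -> quasi_banach Z1 ->
  sum_separated X0 X1 -> sum_separated Y0 Y1 ->
  linear_on (carrier (sum_space X0 X1)) T ->
  linear_on (carrier (sum_space Z0 Z1)) Q ->
  bounded_from_to Z0 X0 Q -> bounded_from_to Z1 X1 Q ->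
  linear_on (carrier (sum_space Z0 Z1)) S ->
  bounded_from_to Z0 Y0 S -> bounded_from_to Z1 Y1 S ->
  (forall w, carrier (sum_space Z0 Z1) w -> T (Q w) = w + S w) ->
  sum_separated Z0 Z1.
Proof.
move=> qX0 qX1 qZ0 qZ1 sX sY lT lQ bQ0 bQ1 lS bS0 bS1 TQ w hw.
have Zw : carrier (sum_space Z0 Z1) w.
  by have [a [b [? ? ? _ _]]] := hw 1 ltr01; exists a, b.
have Qw : Q w = 0.
  apply: sX => e e0; have [c c0 hc] := sum_small_map qZ0 qZ1 lQ bQ0 bQ1.
  (* [Q] enlarges radii by at most the factor [c], so radius [e / c] for [w] yields radius [e] for
     [Q w]; the same is done with [S] below. *)
  have ec : 0 < e / c by rewrite divr_gt0.
  by have := hc _ _ ec (hw _ ec); rewrite mulrC divfK ?gt_eqF.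
have Sw : S w = 0.
  apply: sY => e e0; have [c c0 hc] := sum_small_map qZ0 qZ1 lS bS0 bS1.
  have ec : 0 < e / c by rewrite divr_gt0.
  by have := hc _ _ ec (hw _ ec); rewrite mulrC divfK ?gt_eqF.
have := TQ _ Zw; rewrite Qw Sw addr0 (linear_on0 lT) => [->//|].
by apply: carrier_sum_l => //; exact: carrier0.
Qed.

(** * Convergence in sums and closed graphs *)

Lemma cvg_qnbhs (R : realType) (V : lmodType R[i]) (X : qspace V)
    (u : nat -> V) (x : V) :
  u @ \oo `=>` qnbhs X x <->
  forall e : R, 0 < e ->
    \forall n \near \oo, carrier X (u n) /\ qnorm X (u n - x) < e.
Proof.
split=> [ux e e0|h A [e /= e0 eA]].
  by apply: (ux [set y | carrier X y /\ qnorm X (y - x) < e]); exists e.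
by apply: filterS (h e e0) => n; exact: eA.
Qed.

(** An infimum below [e] is undercut by a decomposition of total norm below [e], so both of its
    components are below [e]. *)
Lemma cvg_sum_small (R : realType) (V : lmodType R[i]) (X0 X1 A : qspace V)
    (u : nat -> V) (x : V) :
  quasi_banach X0 -> quasi_banach X1 -> quasi_banach A ->
  embedded A (sum_space X0 X1) ->
  (forall n, carrier A (u n)) -> carrier A x -> u @ \oo `=>` qnbhs A x ->
  forall e : R, 0 < e -> \forall n \near \oo, sum_small X0 X1 e (u n - x).
Proof.
move=> q0 q1 qA [AX cAX] Au Ax ux e e0.
have /cvg_qnbhs/(_ e e0) : u @ \oo `=>` qnbhs (sum_space X0 X1) x.
  by apply: subset_trans ux; exact: cAX.
apply: filterS => n [_ ne].
(* Some decomposition exists, so the infimum is over a nonempty set and can be approximated from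
   within it. *)
have [a [b [Xa Xb ab]]] := AX _ (carrierB qA (Au n) Ax).
have [|r [a' [b' [Xa' Xb' ab' ->]]] re] := inf_lt _ ne.
  by exists (qnorm X0 a + qnorm X1 b), a, b.
exists a', b'; split=> //; apply: le_lt_trans re.
  by rewrite lerDl (qnorm_ge0 q1).
by rewrite lerDr (qnorm_ge0 q0).
Qed.

Lemma embedded_sum_l (R : realType) (V : lmodType R[i]) (X0 X1 : qspace V) :
  quasi_banach X0 -> quasi_banach X1 -> embedded X0 (sum_space X0 X1).
Proof.
move=> q0 q1; apply: bounded_embedded => //; split.
  exact: carrier_sum_l.
exists 1 => x Xx; rewrite mul1r; apply: ge_inf.
  (* The set of norms is bounded below by 0; the decomposition [x + 0] then bounds its infimum. *)
  exists 0 => _ [a [b [Xa Xb _ ->]]].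
  by rewrite addr_ge0 ?(qnorm_ge0 q0) ?(qnorm_ge0 q1).
exists x, 0; split=> //; [exact: carrier0|by rewrite addr0|].
by rewrite qnorm0// addr0.
Qed.

Lemma embedded_sum_r (R : realType) (V : lmodType R[i]) (X0 X1 : qspace V) :
  quasi_banach X0 -> quasi_banach X1 -> embedded X1 (sum_space X0 X1).
Proof.
move=> q0 q1; apply: bounded_embedded => //; split.
  exact: carrier_sum_r.
exists 1 => x Xx; rewrite mul1r; apply: ge_inf.
  exists 0 => _ [a [b [Xa Xb _ ->]]].
  by rewrite addr_ge0 ?(qnorm_ge0 q0) ?(qnorm_ge0 q1).
exists 0, x; split=> //; [exact: carrier0|by rewrite add0r|].
by rewrite qnorm0// add0r.
Qed.

(** Sequential, to match the sequential form of completeness. [T] is only required to send the terms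
    [u n] into [B], as on the domain of an unbounded operator. *)
Definition closed_graph (R : realType) (V W : lmodType R[i])
    (A : qspace V) (T : V -> W) (B : qspace W) : Prop :=
  forall (u : nat -> V) x y, (forall n, carrier A (u n)) ->
    (forall n, carrier B (T (u n))) -> carrier A x -> carrier B y ->
    u @ \oo `=>` qnbhs A x -> (T \o u) @ \oo `=>` qnbhs B y -> T x = y.

(** In [Z0 + Z1] the sequence [T (u n)] tends to [T x] because [T] is bounded, and to [y] because
    [Y0 + Y1] embeds there; separation forces the limits to agree. Allowing any [A] and [B] embedded
    in the sums covers both the given spaces and the interpolated ones. *)
Lemma closed_graph_sum (R : realType) (V W : lmodType R[i])
    (X0 X1 A : qspace V) (Y0 Y1 Z0 Z1 B : qspace W) (T : V -> W) :
  quasi_banach X0 -> quasi_banach X1 -> quasi_banach Y0 -> quasi_banach Y1 ->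
  quasi_banach Z0 -> quasi_banach Z1 -> quasi_banach A -> quasi_banach B ->
  embedded Y0 Z0 -> embedded Y1 Z1 ->
  linear_on (carrier (sum_space X0 X1)) T ->
  bounded_from_to X0 Z0 T -> bounded_from_to X1 Z1 T ->
  sum_separated Z0 Z1 ->
  embedded A (sum_space X0 X1) -> embedded B (sum_space Y0 Y1) ->
  closed_graph A T B.
Proof.
move=> qX0 qX1 qY0 qY1 qZ0 qZ1 qA qB YZ0 YZ1 lT bT0 bT1 sZ AX BY.
move=> u x y Au Bu Ax By ux uy; apply/eqP; rewrite -subr_eq0; apply/eqP.
have lid : linear_on (carrier (sum_space Y0 Y1)) (@idfun W) by [].
have [c c0 hc] := sum_small_map qX0 qX1 lT bT0 bT1.
have [d d0 hd] := sum_small_map qY0 qY1 lid (embedded_bounded qY0 qZ0 YZ0)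
                                            (embedded_bounded qY1 qZ1 YZ1).
have [b b0 hb] := sum_smallB qZ0 qZ1.
apply: sZ => e e0.
(* Radii are chosen backwards: [T] and the identity enlarge by [c] and [d], the final subtraction by
   [b]. *)
have eb : 0 < e / b by rewrite divr_gt0.
have ec : 0 < e / b / c by rewrite divr_gt0.
have ed : 0 < e / b / d by rewrite divr_gt0.
have [n []] : exists n, sum_small X0 X1 (e / b / c) (u n - x) /\
                        sum_small Y0 Y1 (e / b / d) (T (u n) - y).
  apply: (@filter_ex _ (\oo : set_system nat)); apply: filterI.
    exact: (cvg_sum_small qX0 qX1 qA).
  exact: (cvg_sum_small qY0 qY1 qB BY Bu).
move=> /(hc _ _ ec) + /(hd _ _ ed).
rewrite ![_ * (e / b / _)]mulrC !divfK ?gt_eqF//= => s1 s2.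
(* The terms in [u n] cancel: [(T (u n) - y) - T (u n - x) = T x - y]. *)
have := hb _ _ _ eb s2 s1.
rewrite mulrC divfK ?gt_eqF// (linear_onB lT); last 2 first.
- exact: AX.1.
- exact: AX.1.
by rewrite opprB addrC addrA subrK.
Qed.

(** * Graph spaces *)

(** For completeness, a Cauchy sequence of the graph norm is Cauchy in [A] and has a Cauchy image in
    [B]; the closed graph identifies the limit of the images with the image of the limit. *)
Lemma graph_is_space (R : realType) (k : space_kind) (V W : lmodType R[i])
    (A : qspace V) (T : V -> W) (B : qspace W) :
  is_space k A -> is_space k B -> linear_on (carrier A) T ->
  closed_graph A T B -> is_space k (graph_space A T B).
Proof.
move=> sA sB lT cT.
have qA := is_space_quasi_banach sA; have qB := is_space_quasi_banach sB.
have A0 := carrier0 qA; have B0 := carrier0 qB.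
have qG : quasi_banach (graph_space A T B).
  split=> /=.
  - by rewrite (linear_on0 lT).
  - move=> a x y [Ax Bx] [Ay By]; rewrite lT//.
    by split; exact: carrier_lin.
  - by move=> x [Ax Bx]; rewrite addr_ge0 ?(qnorm_ge0 qA) ?(qnorm_ge0 qB).
  - move=> x [Ax Bx] /eqP; rewrite paddr_eq0 ?(qnorm_ge0 qA) ?(qnorm_ge0 qB)//.
    by move=> /andP[/eqP + _]; exact: qnorm_eq0.
  - move=> a x [Ax Bx]; rewrite (linear_onZ a lT)//.
    by rewrite (qnormZ qA)// (qnormZ qB)// mulrDr.
  - have [c c0 hc] := qnormDM qA; have [d d0 hd] := qnormDM qB.
    exists (c + d) => x y [Ax Bx] [Ay By]; rewrite (linear_onD lT)//.
    apply: le_trans (lerD (hc _ _ Ax Ay) (hd _ _ Bx By)) _.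
    rewrite (addrACA (qnorm A x)) mulrDl; apply: lerD.
      by apply: ler_wpM2l; rewrite ?lerDl ?addr_ge0 ?(qnorm_ge0 qB)// ltW.
    by apply: ler_wpM2l; rewrite ?lerDr ?addr_ge0 ?(qnorm_ge0 qA)// ltW.
  - move=> u Gu cu.
    have Au n : carrier A (u n) := (Gu n).1.
    have Bu n : carrier B (T (u n)) := (Gu n).2.
    have [x Ax ux] : exists2 x, carrier A x & u @ \oo `=>` qnbhs A x.
      apply: (qcomplete qA) => // e /cu[N hN]; exists N => m n Nm Nn.
      apply: le_lt_trans (hN m n Nm Nn) => /=; rewrite (linear_onB lT)//.
      by rewrite lerDl (qnorm_ge0 qB)//; exact: carrierB.
    have [y By uy] : exists2 y, carrier B y & (T \o u) @ \oo `=>` qnbhs B y.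
      apply: (qcomplete qB) => // e /cu[N hN]; exists N => m n Nm Nn.
      apply: le_lt_trans (hN m n Nm Nn) => /=; rewrite (linear_onB lT)//.
      by rewrite lerDr (qnorm_ge0 qA)//; exact: carrierB.
    have Tx := cT u x y Au Bu Ax By ux uy.
    exists x; first by rewrite Tx.
    apply/cvg_qnbhs => e e0; have e20 : 0 < e / 2 by rewrite divr_gt0.
    move/cvg_qnbhs/(_ _ e20) : ux; move/cvg_qnbhs/(_ _ e20) : uy.
    apply: filterS2 => n [_ h1] [_ h2]; split; first exact: Gu.
    by rewrite /= (linear_onB lT)// Tx [e]splitr ltrD.
(* In the Banach case the two triangle inequalities add up to that of the graph norm. *)
case: k sA sB => //= -[_ tA] [_ tB]; split=> // x y [Ax Bx] [Ay By] /=.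
by rewrite (linear_onD lT)// addrACA lerD ?tA ?tB.
Qed.

Lemma graph_bounded_l (R : realType) (V W : lmodType R[i])
    (A : qspace V) (T : V -> W) (B : qspace W) :
  quasi_banach B -> bounded_from_to (graph_space A T B) A idfun.
Proof.
move=> qB; split=> [x []//|]; exists 1 => x [Ax Bx] /=.
by rewrite mul1r lerDl (qnorm_ge0 qB).
Qed.

Lemma graph_bounded_r (R : realType) (V W : lmodType R[i])
    (A : qspace V) (T : V -> W) (B : qspace W) :
  quasi_banach A -> bounded_from_to (graph_space A T B) B T.
Proof.
move=> qA; split=> [x []//|]; exists 1 => x [Ax Bx] /=.
by rewrite mul1r lerDr (qnorm_ge0 qA).
Qed.

Lemma graph_bounded (R : realType) (U V W : lmodType R[i])
    (X : qspace U) (A : qspace V) (T : V -> W) (B : qspace W) (f : U -> V) :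
  bounded_from_to X A f -> bounded_from_to X B (T \o f) ->
  bounded_from_to X (graph_space A T B) f.
Proof.
move=> [fA [c hc]] [fB [d hd]]; split=> [x Xx|].
  by split; [exact: fA|exact: fB].
by exists (c + d) => x Xx /=; rewrite mulrDl lerD ?hc ?hd.
Qed.

(** * The parametrix and its complement as operators into graph spaces *)

(** On [Y] the composition of [T] with [Q] is [1 + S], which is bounded from [Y] to itself since [Y]
    lies in [Z] and [S] maps [Z] to [Y]. *)
Lemma parametrix_graph_bounded (R : realType) (V W : lmodType R[i])
    (X : qspace V) (Y Z : qspace W) (T : V -> W) (Q : W -> V) (S : W -> W) :
  quasi_banach X -> quasi_banach Y -> quasi_banach Z ->
  bounded_from_to Y Z idfun -> bounded_from_to Z X Q -> bounded_from_to Z Y S ->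
  (forall w, carrier Z w -> T (Q w) = w + S w) ->
  bounded_from_to Y (graph_space X T Y) Q.
Proof.
move=> qX qY qZ bYZ bQ bS TQ; apply: graph_bounded.
  exact: (bounded_from_to_comp qZ bYZ bQ).
apply: (@eq_bounded_from_to _ _ _ _ _ (idfun \+ S)).
  by move=> y Yy /=; rewrite TQ//; exact: bYZ.1.
apply: bounded_from_to_add => //; last exact: (bounded_from_to_comp qZ bYZ bS).
by split=> //; exists 1 => y _; rewrite mul1r.
Qed.

(** Applying [T] to [x - Q (T x)] cancels [T x], which is only known to be in [Z], and leaves
    [- S (T x)] in [Y]. *)
Lemma parametrix_graph_bounded_compl (R : realType) (V W : lmodType R[i])
    (X : qspace V) (Y Z : qspace W) (T : V -> W) (Q : W -> V) (S : W -> W) :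
  quasi_banach X -> quasi_banach Y -> quasi_banach Z ->
  linear_on (carrier X) T ->
  bounded_from_to X Z T -> bounded_from_to Z X Q -> bounded_from_to Z Y S ->
  (forall w, carrier Z w -> T (Q w) = w + S w) ->
  bounded_from_to X (graph_space X T Y) (fun x => x - Q (T x)).
Proof.
move=> qX qY qZ lT bT bQ bS TQ.
have bQT := bounded_from_to_comp qZ bT bQ.
apply: graph_bounded.
  apply: (bounded_from_to_add qX _ (bounded_from_to_opp qX bQT)).
  by split=> //; exists 1 => x _; rewrite mul1r.
apply: (@eq_bounded_from_to _ _ _ _ _ (\- (S \o T))).
  move=> x Xx /=; rewrite (linear_onB lT) ?TQ//; last 2 first.
  - exact: bT.1.
  - exact: bQT.1.
  by rewrite opprD addNKr.
exact: bounded_from_to_opp (bounded_from_to_comp qZ bT bS).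
Qed.

(** The ambient space [H] and the map [j] of the pair [[X0, X1]] serve again, because each graph
    space embeds in its [X_j]. *)
Lemma graph_interpolation_pair (R : realType) (k : space_kind)
    (V W : lmodType R[i]) (X0 X1 : qspace V) (Y0 Y1 : qspace W) (T : V -> W) :
  interpolation_pair k X0 X1 -> quasi_banach Y0 -> quasi_banach Y1 ->
  is_space k (graph_space X0 T Y0) -> is_space k (graph_space X1 T Y1) ->
  interpolation_pair k (graph_space X0 T Y0) (graph_space X1 T Y1).
Proof.
move=> [_ _ [H [j [hH lj ij c0 c1]]]] qY0 qY1 sG0 sG1.
have qG0 := is_space_quasi_banach sG0; have qG1 := is_space_quasi_banach sG1.
have [GX0 cG0] := bounded_embedded qG0 (graph_bounded_l X0 T qY0).
have [GX1 cG1] := bounded_embedded qG1 (graph_bounded_l X1 T qY1).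
have GX := carrier_sum_mono GX0 GX1.
split=> //; exists H, j; split=> //.
- exact: linear_onS GX lj.
- move=> x y /set_mem Gx /set_mem Gy; apply: ij; apply/mem_set; exact: GX.
- move=> x Gx; apply: subset_trans (c0 x (GX0 _ Gx)) _ => U; exact: (cG0 x Gx).
- move=> x Gx; apply: subset_trans (c1 x (GX1 _ Gx)) _ => U; exact: (cG1 x Gx).
Qed.

(** * Interpolation of the graph spaces *)

Theorem theorem2p1 (R : realType) (k : space_kind)
    (F : interpolation_functor R k)
    (V W : lmodType R[i])
    (X0 X1 : qspace V) (Y0 Z0 Y1 Z1 : qspace W)
    (T : V -> W) (Q : W -> V) (S : W -> W)
    (hX : interpolation_pair k X0 X1)
    (hY : interpolation_pair k Y0 Y1)
    (hZ0 : is_space k Z0) (hZ1 : is_space k Z1)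
    (hYZ0 : embedded Y0 Z0) (hYZ1 : embedded Y1 Z1)
    (hT : linear_map (carrier (sum_space X0 X1)) (carrier (sum_space Z0 Z1)) T)
    (hT0 : bounded_from_to X0 Z0 T) (hT1 : bounded_from_to X1 Z1 T)
    (hQ : linear_map (carrier (sum_space Z0 Z1)) (carrier (sum_space X0 X1)) Q)
    (hQ0 : bounded_from_to Z0 X0 Q) (hQ1 : bounded_from_to Z1 X1 Q)
    (hS : linear_on (carrier (sum_space Z0 Z1)) S)
    (hS0 : bounded_from_to Z0 Y0 S) (hS1 : bounded_from_to Z1 Y1 S)
    (hTQ : forall w, carrier (sum_space Z0 Z1) w -> T (Q w) = w + S w) :
  exists hG : interpolation_pair k (graph_space X0 T Y0) (graph_space X1 T Y1),
    [/\ linear_map (carrier (interp F hX)) (carrier (sum_space Z0 Z1)) T,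
        carrier (interp F hY) `<=` carrier (sum_space Z0 Z1),
        is_space k (graph_space (interp F hX) T (interp F hY))
      & equal_spaces (interp F hG)
          (graph_space (interp F hX) T (interp F hY))].
Proof.
have [sX0 sX1 _] := hX; have [sY0 sY1 _] := hY.
have [qX0 qX1] := (is_space_quasi_banach sX0, is_space_quasi_banach sX1).
have [qY0 qY1] := (is_space_quasi_banach sY0, is_space_quasi_banach sY1).
have [qZ0 qZ1] := (is_space_quasi_banach hZ0, is_space_quasi_banach hZ1).
have [[lT TXZ] [lQ _]] := (hT, hQ).
have sepZ : sum_separated Z0 Z1.
  exact: (parametrix_separated qX0 qX1 qZ0 qZ1
    (interpolation_pair_separated hX) (interpolation_pair_separated hY)
    lT lQ hQ0 hQ1 hS hS0 hS1 hTQ).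
(* Needed three times: for the two given graph spaces and for the graph space of the interpolated
   ones. *)
have closed A B : quasi_banach A -> quasi_banach B ->
    embedded A (sum_space X0 X1) -> embedded B (sum_space Y0 Y1) ->
    closed_graph A T B.
  by move=> qA qB; exact: (closed_graph_sum qX0 qX1 qY0 qY1 qZ0 qZ1).
have X0X := embedded_sum_l qX0 qX1; have X1X := embedded_sum_r qX0 qX1.
have Y0Y := embedded_sum_l qY0 qY1; have Y1Y := embedded_sum_r qY0 qY1.
have sG0 : is_space k (graph_space X0 T Y0).
  by apply: graph_is_space => //; [exact: linear_onS X0X.1 lT|exact: closed].
have sG1 : is_space k (graph_space X1 T Y1).
  by apply: graph_is_space => //; [exact: linear_onS X1X.1 lT|exact: closed].
have hG : interpolation_pair k (graph_space X0 T Y0) (graph_space X1 T Y1).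
  exact: graph_interpolation_pair.
have qG0 := is_space_quasi_banach sG0; have qG1 := is_space_quasi_banach sG1.
have sFX := interp_space F hX; have sFY := interp_space F hY.
have qFX := is_space_quasi_banach sFX; have qFY := is_space_quasi_banach sFY.
have FXX := interp_sum F hX; have FYY := interp_sum F hY.
have YZ := carrier_sum_mono hYZ0.1 hYZ1.1.
have GX : carrier (sum_space (graph_space X0 T Y0) (graph_space X1 T Y1))
    `<=` carrier (sum_space X0 X1).
  by apply: carrier_sum_mono => x [].
have bidY0 := embedded_bounded qY0 qZ0 hYZ0.
have bidY1 := embedded_bounded qY1 qZ1 hYZ1.
have TQ0 w : carrier Z0 w -> T (Q w) = w + S w.
  by move=> Zw; apply: hTQ; exact: carrier_sum_l.
have TQ1 w : carrier Z1 w -> T (Q w) = w + S w.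
  by move=> Zw; apply: hTQ; exact: carrier_sum_r.
have lG := linear_onS GX lT.
exists hG.
have FXZ : linear_map (carrier (interp F hX)) (carrier (sum_space Z0 Z1)) T.
  by split=> [|x /FXX.1]; [exact: linear_onS FXX.1 lT|exact: TXZ].
have FYZ : carrier (interp F hY) `<=` carrier (sum_space Z0 Z1).
  by move=> y /FYY.1; exact: YZ.
(* Interpolating the identity and [T] bounds the graph norm by the norm of the interpolated graph
   pair. *)
have FG_FX : bounded_from_to (interp F hG) (interp F hX) idfun.
  have [b0 b1] := (graph_bounded_l X0 T qY0, graph_bounded_l X1 T qY1).
  by apply: interp_bounded.
have FG_FY : bounded_from_to (interp F hG) (interp F hY) T.
  have b0 := graph_bounded_r T Y0 qX0; have b1 := graph_bounded_r T Y1 qX1.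
  by apply: interp_bounded => //; exact: linear_map_sum.
(* Interpolating [Q] and [1 - Q T] prepares the reverse estimate. *)
have FY_FG : bounded_from_to (interp F hY) (interp F hG) Q.
  have b0 := parametrix_graph_bounded qX0 qY0 qZ0 bidY0 hQ0 hS0 TQ0.
  have b1 := parametrix_graph_bounded qX1 qY1 qZ1 bidY1 hQ1 hS1 TQ1.
  apply: interp_bounded => //; apply: linear_map_sum => //.
  exact: linear_onS YZ lQ.
have FX_FG : bounded_from_to (interp F hX) (interp F hG) (fun x => x - Q (T x)).
  have b0 := parametrix_graph_bounded_compl qX0 qY0 qZ0
    (linear_onS X0X.1 lT) hT0 hQ0 hS0 TQ0.
  have b1 := parametrix_graph_bounded_compl qX1 qY1 qZ1
    (linear_onS X1X.1 lT) hT1 hQ1 hS1 TQ1.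
  apply: interp_bounded => //; apply: linear_map_sum => //.
  move=> a x y Xx Xy; rewrite lT// lQ; [|exact: TXZ..].
  by rewrite scalerBr opprD addrACA.
have qFG := is_space_quasi_banach (interp_space F hG).
(* In [x = (x - Q (T x)) + Q (T x)] the first term is controlled by the norm of [x] and the second
   by that of [T x], the two summands of the graph norm. *)
have GFG : bounded_from_to (graph_space (interp F hX) T (interp F hY))
    (interp F hG) idfun.
  apply: (@eq_bounded_from_to _ _ _ _ _ ((fun x => x - Q (T x)) \+ (Q \o T))).
    by move=> x _ /=; rewrite subrK.
  apply: (bounded_from_to_add qFG).
    exact: (bounded_from_to_comp qFX (graph_bounded_l _ T qFY) FX_FG).
  exact: (bounded_from_to_comp qFY (graph_bounded_r T _ qFX) FY_FG).
have FGG := graph_bounded FG_FX FG_FY.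
have sFG : is_space k (graph_space (interp F hX) T (interp F hY)).
  by apply: graph_is_space => //; [exact: FXZ.1|exact: closed].
split=> //; split.
  by apply/seteqP; split; [exact: FGG.1|exact: GFG.1].
have [c c0 hc] := bounded_from_to_pos qFG FGG.
have [d d0 hd] := bounded_from_to_pos (is_space_quasi_banach sFG) GFG.
(* One constant must serve both inequalities: [d] bounds the interpolated norm by the graph norm,
   [c] the converse. *)
exists (Num.max c d) => x FGx; have Gx := FGG.1 _ FGx; split.
  apply: (le_trans (hd _ Gx)); apply: ler_wpM2r.
    exact: qnorm_ge0 (is_space_quasi_banach sFG) _ Gx.
  by rewrite le_max lexx orbT.
apply: (le_trans (hc _ FGx)); apply: ler_wpM2r; first exact: qnorm_ge0.
by rewrite le_max lexx.
Qed.
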